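(* Let $1\le m\le n$ be integers, let $\pi=(\pi_1,\dots,\pi_n)$ with $\pi_i=1$ for $1\le i\le m$ and $\pi_i=2$ for $m<i\le n$, and suppose $1+n+\binom{m}{2}=2^t$ for some positive integer $t$. Let $\mathbf{M}\in\mathbb{F}_2^n$ be the vector whose first $m$ entries are $1$ and whose other entries are $0$, and for $0\le k\le m$ let $$D_k=\{\mathbf{v}\in\mathbb{F}_2^n:\ |\mathbf{v}\cap\mathbf{M}|=k,\ |\mathbf{v}|=2^{t-1}-k(m-k)\}.$$ For a function $f:\mathbb{F}_2^n\to\mathbb{R}$ the following are equivalent: (1) $f$ is a weighted $2$-perfect $\pi$-code, i.e. $\sum_{\mathbf{y}\in S_\pi(\mathbf{x};2)}f(\mathbf{y})=1$ for every $\mathbf{x}\in\mathbb{F}_2^n$. (2) There exist real numbers $A_{\mathbf{d}}$ ($\mathbf{d}\in\bigcup_{k=0}^m D_k$) such that $$f(x_1,\dots,x_n)=A_{\mathbf{0}}\,y_{\mathbf{0}}(x_1,\dots,x_n)+\sum_{k=0}^m\sum_{\mathbf{d}\in D_k}A_{\mathbf{d}}\,y_{\mathbf{d}}(x_1,\dots,x_n),$$ where $A_{\mathbf{0}}=\frac{2^n}{|S_\pi(\mathbf{0};2)|}=2^{n-t}$.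
   Context: The $\pi$-weight of $\mathbf{x}\in\mathbb{F}_2^n$ is $w_\pi(\mathbf{x})=\sum_{i=1}^n\pi_i x_i$ (entries regarded as integers $0,1$), $d_\pi(\mathbf{x},\mathbf{y})=w_\pi(\mathbf{x}-\mathbf{y})$, and $S_\pi(\mathbf{x};r)=\{\mathbf{y}\in\mathbb{F}_2^n: d_\pi(\mathbf{x},\mathbf{y})\le r\}$; for the given $\pi$, $|S_\pi(\mathbf{x};2)|=1+n+\binom{m}{2}=2^t$. Vectors of $\mathbb{F}_2^n$ are identified with their supports, so $|\mathbf{v}|$ is the number of nonzero coordinates of $\mathbf{v}$ and $|\mathbf{v}\cap\mathbf{M}|$ is the number of $i\le m$ with $v_i=1$. A function $f:\mathbb{F}_2^n\to\mathbb{R}$ is identified with the polynomial $f(x_1,\dots,x_n)=\sum_{\mathbf{t}\in\mathbb{F}_2^n}f(\mathbf{t})x_1^{t_1}\cdots x_n^{t_n}$ in $\mathbb{R}[x_1,\dots,x_n]/(x_i^2-1)_{i=1}^n$ (exponents regarded as integers $0,1$), and for $\mathbf{d}\in\mathbb{F}_2^n$ $$y_{\mathbf{d}}(x_1,\dots,x_n)=\frac{1}{2^n}\prod_{i=1}^n(1-x_i)^{d_i}(1+x_i)^{1-d_i}.$$ The $y_{\mathbf{d}}$, $\mathbf{d}\in\mathbb{F}_2^n$, form a basis of this quotient ring. *)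

(* Defs.v *)
From HB Require Import structures.
From mathcomp Require Import all_boot all_order all_algebra ring_quotient.
From mathcomp Require Import boolp reals.
From mathcomp Require Import mpoly.

Set Implicit Arguments.
Unset Strict Implicit.
Unset Printing Implicit Defensive.

Import Order.TTheory GRing.Theory Num.Theory.
Local Open Scope ring_scope.
Local Open Scope quotient_scope.

Section PiMetric.
Variables (n : nat) (w : 'I_n -> nat).
Implicit Types x y : 'rV['F_2]_n.

(* An entry [x 0 i : 'F_2] coerces to the natural number 0 or 1. *)
Definition pi_weight x : nat := (\sum_(i < n) w i * x 0%R i)%N.

Definition pi_dist x y : nat := pi_weight (x - y).

Definition pi_ball x (r : nat) : {set 'rV['F_2]_n} :=
  [set y | (pi_dist x y <= r)%N].

Definition weighted_perfect_code (R : realType) (r : nat)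
    (f : 'rV['F_2]_n -> R) : Prop :=
  forall x, \sum_(y in pi_ball x r) f y = 1.

End PiMetric.

Section Supports.
Variable n : nat.

Definition vsupp (v : 'rV['F_2]_n) : {set 'I_n} := [set i | v 0 i != 0].

Definition Mvec (m : nat) : 'rV['F_2]_n :=
  \row_(i < n) (if (i < m)%N then 1 else 0).

(* The weight condition is an equation in [int], so that the subtraction
   [2 ^ (t - 1) - k * (m - k)] is not truncated. *)
Definition Dset (m t k : nat) : {set 'rV['F_2]_n} :=
  [set v | (#|vsupp v :&: vsupp (Mvec m)| == k)
           && (Posz #|vsupp v| == 2 ^+ t.-1 - k%:Z * (m%:Z - k%:Z))].

End Supports.

Section QuotientRing.
Variables (R : realType) (n : nat).

(* Membership in the ideal (x_i ^ 2 - 1)_i; [asbool] makes it a boolean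
   predicate, as the quotient construction requires. *)
Definition sqr1_ideal : {pred {mpoly R[n]}} :=
  fun p => `[< exists g : 'I_n -> {mpoly R[n]},
                 p = \sum_(i < n) g i * ('X_i ^+ 2 - 1) >].

Lemma sqr1_idealP p :
  reflect (exists g : 'I_n -> {mpoly R[n]},
             p = \sum_(i < n) g i * ('X_i ^+ 2 - 1))
          (p \in sqr1_ideal).
Proof. exact: asboolP. Qed.

Lemma sqr1_ideal_closed : idealr_closed sqr1_ideal.
Proof.
split.
- by apply/sqr1_idealP; exists (fun=> 0); rewrite big1 // => i _; rewrite mul0r.
- apply/negP => /sqr1_idealP[g /(congr1 (meval (fun=> 1)))].
  rewrite rmorph1 raddf_sum big1 => [/eqP|i _] /=.
    by rewrite oner_eq0.
  by rewrite rmorphM rmorphB rmorphXn rmorph1 /= mevalXU expr1n subrr mulr0.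
- move=> a _ _ /sqr1_idealP[g ->] /sqr1_idealP[h ->]; apply/sqr1_idealP.
  exists (fun i => a * g i + h i); rewrite mulr_sumr -big_split /=.
  by apply: eq_bigr => i _; rewrite mulrDl mulrA.
Qed.

HB.instance Definition _ :=
  isIdealr.Build {mpoly R[n]} sqr1_ideal sqr1_ideal_closed.

Definition Qring := {ideal_quot sqr1_ideal}.

Definition Qproj : {mpoly R[n]} -> Qring := \pi_Qring.

Definition Qvar (i : 'I_n) : Qring := Qproj 'X_i.

(* The scalar [c : R] seen in the quotient ring; this is the R-algebra
   structure inherited from the polynomial ring. *)
Definition Qconst (c : R) : Qring := Qproj c%:MP.

Definition fun_poly (f : 'rV['F_2]_n -> R) : Qring :=
  \sum_(s : 'rV['F_2]_n) Qconst (f s) * \prod_(i < n) Qvar i ^+ s 0 i.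

Definition ybasis (d : 'rV['F_2]_n) : Qring :=
  Qconst (2 ^+ n)^-1 *
  \prod_(i < n) ((1 - Qvar i) ^+ d 0 i * (1 + Qvar i) ^+ (1 - d 0%R i)%N).

End QuotientRing.

(* Main.v *)
(* Being a perfect code is the convolution equation f * 1_B = 1, where B is
   the ball of radius 2 at 0, so by Fourier inversion it says that
   fhat(d) Bhat(d) = 2^n [d = 0] for all d.  Up to the factor 2^-n, [ybasis d]
   is the polynomial of the character of d, so the numbers A_d are the Fourier
   coefficients of f.  With k the size of the intersection of d and M,
   Bhat(d) = 2^t - 2|d| - 2k(m-k), which vanishes exactly on the D_k, and
   Bhat(0) = |B| = 2^t. *)
Require Import Defs.
From HB Require Import structures.
From mathcomp Require Import all_boot all_order all_algebra ring_quotient.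
From mathcomp Require Import boolp reals.
From mathcomp Require Import mpoly.
From mathcomp Require Import ring lra.

Set Implicit Arguments.
Unset Strict Implicit.
Unset Printing Implicit Defensive.

Import Order.TTheory GRing.Theory Num.Theory.
Local Open Scope ring_scope.

(** * Sums and products over F_2^n *)

Lemma big_F2 (S : nmodType) (F : 'F_2 -> S) : \sum_a F a = F 0 + F 1.
Proof.
rewrite big_ord_recl big_ord1; congr (F _ + F _); exact: val_inj.
Qed.

Lemma F2_cases (a : 'F_2) : a = 0 \/ a = 1.
Proof.
by case: a => [[|[|k]] Hk] //; [left|right]; exact: val_inj.
Qed.

Lemma oppr_F2 n (x : 'rV['F_2]_n) : - x = x.
Proof.
by apply/rowP => i; rewrite mxE; case: (F2_cases (x 0 i)) => ->; exact: val_inj.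
Qed.

(** Distributivity: picking one summand in each factor amounts to picking a vector [s]. Every sum
    over F_2^n of a product over coordinates is factored this way below. *)
Lemma prod_sum_F2 (S : comNzRingType) n (F : 'I_n -> 'F_2 -> S) :
  \prod_i (F i 0 + F i 1) = \sum_(s : 'rV['F_2]_n) \prod_i F i (s 0 i).
Proof.
under eq_bigr do rewrite -big_F2.
rewrite bigA_distr_bigA /=.
rewrite (reindex (fun s : 'rV['F_2]_n => [ffun i => s 0 i])) /=; last first.
  exists (fun g : {ffun _} => \row_i g i) => [s _ | g _].
    by apply/rowP => i; rewrite mxE ffunE.
  by apply/ffunP => i; rewrite ffunE mxE.
by apply: eq_bigr => s _; apply: eq_bigr => i _; rewrite ffunE.
Qed.

(** * Characters of F_2^n and Fourier inversion *)

Section Characters.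
Variables (R : realType) (n : nat).
Implicit Types (d s : 'rV['F_2]_n) (f g : 'rV['F_2]_n -> R).

Definition signs d (i : 'I_n) : R := (-1) ^+ (d 0%R i : nat).

(** This is (-1)^(d.s), written as the monomial x^s evaluated at the point [signs d] of {1,-1}^n, so
    that evaluating [fun_poly f] at that point gives [fourier f d]. *)
Definition character d s : R := \prod_i signs d i ^+ s 0 i.

Definition fourier f d : R := \sum_s f s * character d s.

Lemma signs_sqr d i : signs d i * signs d i = 1.
Proof. by rewrite /signs -exprD addnn -muln2 mulnC exprM sqrrN expr1n expr1n. Qed.

Lemma characterC d s : character d s = character s d.
Proof.
by apply: eq_bigr => i _; rewrite /signs -!exprM mulnC.
Qed.

Lemma character0 s : character 0 s = 1.
Proof. by apply: big1 => i _; rewrite /signs mxE expr0 expr1n. Qed.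

Lemma characterD d s1 s2 :
  character d (s1 + s2) = character d s1 * character d s2.
Proof.
rewrite -big_split /=; apply: eq_bigr => i _; rewrite mxE.
case: (F2_cases (s1 0 i)) => ->; case: (F2_cases (s2 0 i)) => ->;
  rewrite ?add0r ?addr0 ?expr0 ?mul1r ?mulr1 //.
by rewrite expr1 signs_sqr.
Qed.

(** The sum factors over the coordinates: each factor is 2 if d = d', and a coordinate where d and
    d' differ gives the factor 1 + (-1) = 0. *)
Lemma character_orthogonal d d' :
  \sum_s character d s * character d' s = 2 ^+ n *+ (d == d').
Proof.
pose F i (a : 'F_2) := signs d i ^+ a * signs d' i ^+ a.
transitivity (\prod_i (F i 0 + F i 1)).
  by rewrite prod_sum_F2; apply: eq_bigr => s _; rewrite -big_split.
have [dd'|neq] := eqVneq d d'.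
  rewrite (eq_bigr (fun=> 2%:R)) ?prodr_const ?card_ord // => i _.
  by rewrite /F -dd' !expr0 !expr1 signs_sqr mulr1.
have [i di] : exists i, d 0 i != d' 0 i.
  apply/existsP; apply: contraNT neq => /existsPn e.
  by apply/eqP/rowP => i; apply/eqP; rewrite -[_ == _]negbK e.
rewrite mulr0n (bigD1 i) //= [X in X * _](_ : _ = 0) ?mul0r //.
move: di; rewrite /F /signs.
by case: (F2_cases (d 0 i)) => ->; case: (F2_cases (d' 0 i)) => -> //= _;
  rewrite ?expr0 ?expr1 ?mul1r ?mulr1 subrr.
Qed.

Lemma fourier_inversion f s :
  \sum_d fourier f d * character d s = 2 ^+ n * f s.
Proof.
under eq_bigr do rewrite mulr_suml.
rewrite exchange_big /=.
transitivity (\sum_s' f s' * (2 ^+ n *+ (s' == s))).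
  apply: eq_bigr => s' _; rewrite -character_orthogonal mulr_sumr.
  by apply: eq_bigr => d _; rewrite -mulrA !(characterC d).
rewrite (bigD1 s) //= eqxx mulr1n big1 ?addr0 1?mulrC // => s' /negPf ->.
by rewrite mulr0n mulr0.
Qed.

Lemma fourier_inj f g : fourier f =1 fourier g -> f =1 g.
Proof.
move=> fg s; have nz : 2 ^+ n != 0 :> R by rewrite expf_neq0 ?pnatr_eq0.
apply: (mulfI nz); rewrite -!fourier_inversion.
by apply: eq_bigr => d _; rewrite fg.
Qed.

Lemma fourier_const1 d : fourier (fun=> 1) d = 2 ^+ n *+ (d == 0).
Proof.
rewrite -character_orthogonal; apply: eq_bigr => s _.
by rewrite character0 mulr1 mul1r.
Qed.

Lemma fourier_character_sum (A : 'rV['F_2]_n -> R) (P : pred 'rV['F_2]_n) d :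
  fourier (fun s => (2 ^+ n)^-1 * \sum_(e | P e) A e * character e s) d
  = if P d then A d else 0.
Proof.
have nz : 2 ^+ n != 0 :> R by rewrite expf_neq0 ?pnatr_eq0.
rewrite /fourier.
under eq_bigr do rewrite -mulrA mulr_suml.
rewrite -mulr_sumr exchange_big /=.
rewrite (eq_bigr (fun e => A e * (2 ^+ n *+ (e == d)))); last first.
  move=> e _; rewrite -character_orthogonal mulr_sumr.
  by apply: eq_bigr => s _; rewrite mulrA.
case: ifP => Pd.
  rewrite (bigD1 d) //= eqxx mulr1n big1 ?addr0 => [|e /andP[_ /negPf ->]].
    by rewrite mulrCA mulVf ?mulr1.
  by rewrite mulr0n mulr0.
rewrite big1 ?mulr0 // => e Pe; case: eqVneq => [ed|_]; last by rewrite mulr0n mulr0.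
by rewrite ed Pd in Pe.
Qed.

(** * Functions as elements of the quotient ring *)

Lemma Qproj_is_rmorphism : exists pr : {rmorphism {mpoly R[n]} -> Qring R n},
  forall p, Qproj p = pr p.
Proof.
by eexists (\pi_(Qring R n)%qT : {rmorphism _ -> _}).
Qed.

(* The relations X_i^2 = 1 hold at points with coordinates +1 or -1. *)
Lemma Qproj_eq_meval (p q : {mpoly R[n]}) d :
  Qproj p = Qproj q -> meval (signs d) p = meval (signs d) q.
Proof.
move=> /eqP; rewrite /Qproj -Quotient.idealrBE => /sqr1_idealP[g pq].
apply/eqP; rewrite -subr_eq0 -rmorphB pq raddf_sum big1 //= => i _.
by rewrite rmorphM rmorphB rmorphXn rmorph1 /= mevalXU expr2 signs_sqr subrr mulr0.
Qed.

(** Evaluation at [signs d] is well defined on the quotient and yields the Fourier coefficient at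
    [d]; these coefficients determine the function. *)
Lemma fun_poly_inj f g : fun_poly f = fun_poly g -> f =1 g.
Proof.
have [pr prE] := Qproj_is_rmorphism.
pose P f : {mpoly R[n]} := \sum_s (f s)%:MP * \prod_i 'X_i ^+ s 0 i.
have PE h : fun_poly h = Qproj (P h).
  rewrite prE rmorph_sum; apply: eq_bigr => s _.
  rewrite rmorphM rmorph_prod /Qconst prE; congr (_ * _).
  by apply: eq_bigr => i _; rewrite rmorphXn /Qvar prE.
have PF h d : meval (signs d) (P h) = fourier h d.
  rewrite raddf_sum; apply: eq_bigr => s _ /=.
  rewrite rmorphM rmorph_prod /= mevalC; congr (_ * _).
  by apply: eq_bigr => i _; rewrite rmorphXn /= mevalXU.
rewrite !PE => e; apply: fourier_inj => d; rewrite -!PF; exact: Qproj_eq_meval.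
Qed.

(** The i-th factor of [ybasis R d] is 1 + (-1)^(d_i) x_i, so expanding the product gives 2^n y_d as
    the sum over s of [character d s] x^s. *)
Lemma fun_poly_character_sum (A : 'rV['F_2]_n -> R) (P : pred 'rV['F_2]_n) :
  \sum_(d | P d) Qconst n (A d) * ybasis R d
  = fun_poly (fun s => (2 ^+ n)^-1 * \sum_(d | P d) A d * character d s).
Proof.
have [pr prE] := Qproj_is_rmorphism.
have QM a b : Qconst n (a * b : R) = Qconst n a * Qconst n b.
  by rewrite /Qconst !prE mpolyCM rmorphM.
have Q_sum I r (Q : pred I) (F : I -> R) :
    Qconst n (\sum_(i <- r | Q i) F i) = \sum_(i <- r | Q i) Qconst n (F i).
  by rewrite /Qconst prE !raddf_sum; apply: eq_bigr => i _; rewrite prE.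
have Q_signs d i : Qconst n (signs d i) = (-1) ^+ (d 0%R i : nat).
  by rewrite /Qconst prE /signs rmorphXn rmorphN1 !rmorphXn rmorphN1.
have Q_char d s : Qconst n (character d s) = \prod_i Qconst n (signs d i) ^+ s 0 i.
  rewrite /Qconst prE !rmorph_prod; apply: eq_bigr => i _.
  by rewrite prE !rmorphXn.
rewrite /fun_poly.
under [RHS]eq_bigr do rewrite mulr_sumr Q_sum mulr_suml.
rewrite [RHS]exchange_big /=; apply: eq_bigr => d _.
pose F i (a : 'F_2) := Qconst n (signs d i) ^+ a * Qvar R i ^+ a.
rewrite /ybasis (eq_bigr (fun i => F i 0 + F i 1)); last first.
  move=> i _; rewrite /F Q_signs !expr0 !expr1.
  by case: (F2_cases (d 0 i)) => ->; rewrite /= ?expr0 ?expr1 ?mul1r ?mulr1 ?mulN1r.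
rewrite (prod_sum_F2 F) !mulr_sumr; apply: eq_bigr => s _.
by rewrite !QM Q_char big_split /=; ring.
Qed.

(** * The transform of the ball and the convolution equation *)

Section Ball.
Variables (w : 'I_n -> nat) (r : nat).

Definition ball_transform d : R := \sum_(z in pi_ball w 0 r) character d z.

Lemma fourier_ball_sum f d :
  fourier (fun x => \sum_(y in pi_ball w x r) f y) d = fourier f d * ball_transform d.
Proof.
rewrite /fourier mulr_suml.
under eq_bigr do rewrite mulr_suml.
rewrite (exchange_big_dep predT) //=; apply: eq_bigr => y _.
(* Convolution: with x = y + z, y lies in the ball around x exactly when z lies in the ball around
   0, because -z = z. *)
rewrite /ball_transform mulr_sumr (reindex_inj (addrI y)) /=.
apply: eq_big => [z|z _].
  by rewrite !inE /pi_dist addrAC subrr !add0r oppr_F2.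
by rewrite characterD mulrA.
Qed.

Lemma weighted_perfect_codeP f : weighted_perfect_code w r f <->
  forall d, fourier f d * ball_transform d = 2 ^+ n *+ (d == 0).
Proof.
split=> [pf d|fB x].
  rewrite -fourier_ball_sum -fourier_const1; apply: eq_bigr => x _.
  by rewrite pf.
apply: (@fourier_inj (fun x => \sum_(y in pi_ball w x r) f y) (fun=> 1)) => d.
by rewrite fourier_ball_sum fB fourier_const1.
Qed.

Lemma ball_transform0 : ball_transform 0 = #|pi_ball w 0 r|%:R.
Proof.
by rewrite /ball_transform (eq_bigr (fun=> 1)) ?sumr_const // => z _; rewrite character0.
Qed.

(* The generating function of the pi-weight, twisted by a character, is a product. *)
Lemma ball_transform_coef d : ball_transform d =
  \sum_(k < r.+1) (\prod_i (1 + signs d i *: 'X^(w i)) : {poly R})`_k.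
Proof.
pose F i (a : 'F_2) : {poly R} := signs d i ^+ a *: 'X^(w i * a).
have -> : \prod_i (1 + signs d i *: 'X^(w i)) =
    \sum_(z : 'rV['F_2]_n) character d z *: 'X^(pi_weight w z) :> {poly R}.
  transitivity (\prod_i (F i 0 + F i 1)).
    by apply: eq_bigr => i _; rewrite /F muln0 muln1 !expr0 expr1 scale1r.
  rewrite prod_sum_F2; apply: eq_bigr => z _.
  rewrite -mul_polyC rmorph_prod /pi_weight -prodrXr -big_split /=.
  by apply: eq_bigr => i _; rewrite mul_polyC.
under [RHS]eq_bigr do rewrite coef_sum.
rewrite exchange_big /= /ball_transform big_mkcond; apply: eq_bigr => z _ /=.
under eq_bigr do rewrite coefZ coefXn.
(* Each [z] contributes only to the coefficient of index [pi_weight w z], which is among the r + 1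
   summed ones exactly when [z] is in the ball. *)
rewrite inE /pi_dist sub0r oppr_F2; case: leqP => [le_r|lt_r]; last first.
  by rewrite big1 // => k _; rewrite ltn_eqF ?mulr0 // (leq_trans (ltn_ord k)).
rewrite (bigD1 (Ordinal (le_r : _ < r.+1)%N)) //= eqxx mulr1 big1 ?addr0 //.
by move=> k; rewrite -val_eqE /= => /negPf ->; rewrite mulr0.
Qed.

End Ball.

End Characters.

(** * The transform of the ball of radius 2 for weights 1 and 2 *)

(** Degree 2 arises from one factor of weight 2 or from two of weight 1. The latter give the second
    elementary symmetric sum, and Newton's identity 2 e_2 = p_1^2 - p_2 applies, where p_2 is a
    count since the squares are 1. Doubling avoids division. *)
Lemma prod_low_coef (R : comNzRingType) (I : Type) (s : seq I) (e : I -> R)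
    (w : I -> nat) (P := \prod_(i <- s) (1 + e i *: 'X^(w i)) : {poly R}) :
    (forall i, e i * e i = 1) -> (forall i, w i = 1 \/ w i = 2)%N ->
  [/\ P`_0 = 1, P`_1 = \sum_(i <- s | w i == 1) e i
    & P`_2 *+ 2 = (\sum_(i <- s | w i == 2) e i) *+ 2
                  + P`_1 ^+ 2 - \sum_(i <- s | w i == 1) 1].
Proof.
rewrite {}/P => e2 w12; elim: s => [|i s [IH0 IH1 IH2]].
  by rewrite !big_nil !coef1; split=> //=; ring.
rewrite !big_cons !mulrDl !mul1r !coefD -!scalerAl !coefZ !coefXnM.
case: (w12 i) => -> /=; split=> //; rewrite ?IH0 ?mulr0 ?addr0 ?mulr1 -?IH1 //.
- by rewrite addrC.
- by have := e2 i; rewrite mulrnDl IH2 => ei; ring: ei.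
- by rewrite mulrnDl IH2; ring.
Qed.

Section TwoLevelWeight.
Variables (R : realType) (m n : nat) (w : 'I_n -> nat).
Hypothesis le_mn : (m <= n)%N.
Hypothesis w1 : forall i : 'I_n, (i < m)%N -> w i = 1%N.
Hypothesis w2 : forall i : 'I_n, (m <= i)%N -> w i = 2%N.

Lemma mem_vsupp_Mvec i : (i \in vsupp (Mvec n m)) = (i < m)%N.
Proof. by rewrite inE mxE; case: ifP; rewrite ?oner_eq0 ?eqxx. Qed.

Lemma card_vsupp_Mvec : #|vsupp (Mvec n m)| = m.
Proof.
rewrite -sum1_card (eq_bigl _ _ mem_vsupp_Mvec) -(big_ord_widen n (fun=> 1%N)) //.
by rewrite sum_nat_const card_ord muln1.
Qed.

Lemma sum_signs (d : 'rV['F_2]_n) (B : {set 'I_n}) :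
  \sum_(i in B) signs R d i = #|B|%:R - #|vsupp d :&: B|%:R *+ 2.
Proof.
rewrite -!sum1_card !natr_sum -sumrMnl.
rewrite [X in _ - X](eq_bigl (fun i => (i \in B) && (i \in vsupp d))).
  rewrite [X in _ - X]big_mkcondr -sumrB; apply: eq_bigr => i _.
  rewrite inE /signs; case: (F2_cases (d 0 i)) => -> /=.
    by rewrite subr0.
  by rewrite expr1; ring.
by move=> i; rewrite inE andbC.
Qed.

(** The signs sum to m - 2k over M and to n - m - 2(|d| - k) over its complement. In the degree 2
    coefficient, ((m - 2k)^2 - m)/2 equals C(m,2) - 2k(m-k). *)
Lemma ball_transform_radius2 (d : 'rV['F_2]_n) (k := #|vsupp d :&: vsupp (Mvec n m)|) :
  ball_transform R w 2 d =
    (1 + n + 'C(m, 2))%:R - #|vsupp d|%:R *+ 2 - k%:R * (m%:R - k%:R) *+ 2.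
Proof.
pose M := vsupp (Mvec n m).
have wM i : (w i == 1%N) = (i \in M).
  by rewrite mem_vsupp_Mvec; case: ltnP => [/w1|/w2] ->.
have wM' i : (w i == 2%N) = (i \in ~: M).
  by rewrite inE mem_vsupp_Mvec; case: ltnP => [/w1|/w2] ->.
have w12 i : (w i = 1 \/ w i = 2)%N by case: (ltnP i m) => [/w1|/w2]; [left|right].
have [c0 c1 c2] := prod_low_coef (index_enum 'I_n) (signs_sqr R d) w12.
rewrite ball_transform_coef !big_ord_recl big_ord0 addr0 /= c0.
move: c1 c2; set p1 := _`_1; set p2 := _`_2.
rewrite !(eq_bigl _ _ wM) !(eq_bigl _ _ wM') !sum_signs.
rewrite sumr_const card_vsupp_Mvec -/k => c1 c2.
have cM : #|~: M|%:R = n%:R - m%:R :> R.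
  by rewrite cardsCs setCK card_ord card_vsupp_Mvec natrB.
have cD : #|vsupp d :&: ~: M|%:R = #|vsupp d|%:R - k%:R :> R.
  by rewrite -setDE cardsD natrB // subset_leq_card ?subsetIl.
have bin : 'C(m, 2)%:R *+ 2 = m%:R ^+ 2 - m%:R :> R.
  elim: (m) => [|j IH]; first by rewrite bin_small //; ring.
  by rewrite binS bin1 natrD mulrnDl IH -natr1; ring.
rewrite cM cD c1 in c2; rewrite c1 !natrD; lra.
Qed.

End TwoLevelWeight.

(** * Perfect codes as functions with prescribed Fourier support *)

Theorem proposition3p5 (R : realType) (m n t : nat) (w : 'I_n -> nat)
    (m_gt0 : (1 <= m)%N) (le_mn : (m <= n)%N) (t_gt0 : (0 < t)%N)
    (w1 : forall i : 'I_n, (i < m)%N -> w i = 1%N)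
    (w2 : forall i : 'I_n, (m <= i)%N -> w i = 2%N)
    (sphere : (1 + n + 'C(m, 2) = 2 ^ t)%N)
    (f : 'rV['F_2]_n -> R) :
  (2 ^+ n / #|pi_ball w 0 2|%:R = 2 ^ (n%:Z - t%:Z) :> R) /\
  (weighted_perfect_code w 2 f <->
   exists A : 'rV['F_2]_n -> R,
     A 0 = 2 ^+ n / #|pi_ball w 0 2|%:R /\
     fun_poly f = Qconst n (A 0) * ybasis R 0
       + \sum_(k < m.+1) \sum_(d in Dset n m t k) Qconst n (A d) * ybasis R d).
Proof.
pose M := vsupp (Mvec n m).
pose B d := ball_transform R w 2 d.
(* Since t > 0, a factor 2 comes out of 2^t; the cofactor is an integer whose vanishing is the
   weight condition of [Dset]. *)
have BE d (k := #|vsupp d :&: M|) :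
    B d = 2 * (2 ^+ t.-1 - k%:Z * (m%:Z - k%:Z) - #|vsupp d|%:Z)%:~R.
  rewrite /B (ball_transform_radius2 R le_mn w1 w2) sphere natrX.
  rewrite -{1}(prednK t_gt0) exprS.
  by rewrite !rmorphB rmorphM rmorphXn /= rmorphB /=; ring.
have B_eq0 d : (B d == 0) = (d \in Dset n m t #|vsupp d :&: M|).
  rewrite BE mulf_eq0 pnatr_eq0 /= intr_eq0 inE eqxx /=.
  by rewrite subr_eq0 eq_sym.
have B0 : B 0 = 2 ^+ t.
  rewrite /B (ball_transform_radius2 R le_mn w1 w2) sphere natrX.
  have -> : vsupp 0 = set0 :> {set 'I_n} by apply/setP => i; rewrite !inE mxE eqxx.
  by rewrite set0I cards0; ring.
have nz k : 2 ^+ k != 0 :> R by rewrite expf_neq0 ?pnatr_eq0.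
have cardB : #|pi_ball w 0 2|%:R = 2 ^+ t :> R by rewrite -ball_transform0.
(* The D_k are disjoint, as [d] determines k, and none contains 0, as B 0 = 2^t is nonzero. Hence
   all terms form a single sum. *)
have double_sum (G : 'rV['F_2]_n -> Qring R n) :
    G 0 + \sum_(k < m.+1) \sum_(d in Dset n m t k) G d
    = \sum_(d | (d == 0) || (B d == 0)) G d.
  rewrite [RHS](bigD1 0) ?eqxx //=; congr (_ + _).
  rewrite (exchange_big_dep predT) //= [RHS]big_mkcond; apply: eq_bigr => d _.
  have le_k : (#|vsupp d :&: M| < m.+1)%N.
    by rewrite ltnS -[leqRHS](card_vsupp_Mvec le_mn) subset_leq_card ?subsetIr.
  have -> : ((d == 0) || (B d == 0)) && (d != 0) = (B d == 0).
    by have [->|] := eqVneq d 0; rewrite /= ?B0 ?andbT // (negPf (nz _)).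
  rewrite B_eq0; case: ifP => Dd.
    rewrite (bigD1 (Ordinal le_k)) //= big1 ?addr0 // => k /andP[].
    by rewrite inE => /andP[/eqP dk _] /eqP; case; exact: val_inj.
  rewrite big1 // => k; rewrite inE => /andP[/eqP dk dt].
  by move: Dd; rewrite inE eqxx /= dk dt.
split; first by rewrite cardB expfzDr ?pnatr_eq0 // -exprnN.
rewrite cardB weighted_perfect_codeP; split=> [fB|[A [A0 fA]] d].
  (* At 0 the code equation reads A_0 2^t = 2^n; at any other d with B d nonzero it forces the
     coefficient to vanish. *)
  exists (fourier f); split.
    by have := fB 0; rewrite -/(B 0) B0 eqxx mulr1n => <-; rewrite mulfK.
  rewrite double_sum fun_poly_character_sum.
  congr fun_poly; apply/funext/fourier_inj => d; rewrite fourier_character_sum.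
  have := fB d; rewrite -/(B d); case: eqVneq => //= d0 /eqP; rewrite mulf_eq0.
  by case: (B d == 0) => //; rewrite orbF => /eqP.
(* With these coefficients, for d nonzero either B d or [fourier f d] is 0. The coefficients
   themselves are read off from [fA] by injectivity of [fun_poly]. *)
rewrite (_ : fourier f d = if (d == 0) || (B d == 0) then A d else 0).
  rewrite -/(B d); case: eqVneq => [->|d0] /=; first by rewrite A0 B0 mulfVK.
  by case: eqP => [->|_]; rewrite ?mulr0 ?mul0r.
rewrite -(fourier_character_sum A (fun e => (e == 0) || (B e == 0))).
congr fourier; apply/funext/fun_poly_inj.
by rewrite fA double_sum fun_poly_character_sum.
Qed.
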